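(* Let $n,M$ be positive integers, let $q_1,\dots,q_n>0$ be real numbers with $\sum_{j=1}^n q_j=M$, and let $d_0\ge 0$ be a real number. Let $\psi(\mathbf m)=\sum_{j=1}^n\varphi_j(m_j)$ with $$\varphi_j(x)=\frac1{q_j}\left(x-q_j+d_0-\tfrac12\right)^2 .$$ Then $\psi$ is a decomposable error function, and the linear divisor method given by $d_0$ is obtained from the algorithm MinimalSolution for $\psi$; that is, the set of seat vectors output by MinimalSolution for $\psi$ is equal to the set of seat vectors produced by the linear divisor method given by $d_0$ for the exact quotas $(q_1,\dots,q_n)$.
   Context: $\mathbb N=\{0,1,2,\dots\}$, and $\mathcal M=\{(m_1,\dots,m_n)\in\mathbb Z^n: m_j\ge0,\ \sum_j m_j=M\}$ is the set of possible allocations of $M$ seats to $n$ parties; $q_j$ is the exact quota (exact proportional share of seats) of party $j$. Decomposable error function: a function $\psi:\mathcal M\to\mathbb R_{\ge0}$ of the form $\psi(\mathbf m)=\sum_{j=1}^n\varphi_j(m_j)$ with $\varphi_j:\mathbb N\to\mathbb R_{\ge0}$ such that $H_j(\ell)=\varphi_j(\ell)-\varphi_j(\ell-1)$, $\ell\ge1$, is (weakly) increasing in $\ell$ for each $j$. Algorithm MinimalSolution for $\psi$: it outputs the vectors $\mathbf m\in\mathcal M$ such that the multiset $\{H_j(\ell):1\le\ell\le m_j,\ 1\le j\le n\}$ is the multiset of the $M$ smallest entries, counted with multiplicity, of the $M\times n$ matrix with entry $H_j(\ell)$ in row $\ell$, column $j$ (several output vectors are possible in case of ties). Linear divisor method given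 by $d_0$: let $d_\ell=d_0+(\ell-1)$ for $\ell=1,2,\dots$. Form the $M\times n$ matrix whose entry in row $\ell$ and column $k$ is $q_k/d_\ell$ (with $q_k/0=+\infty$). Select $M$ largest entries of this matrix (ties broken arbitrarily), and let $m_k$ be the number of entries selected from column $k$; party $k$ gets $m_k$ seats. The set of seat vectors produced by the method is the set of all $(m_1,\dots,m_n)$ arising from all possible ways of breaking ties. *)

(* Defs.v *)
From mathcomp Require Import all_boot all_order all_algebra.
From mathcomp Require Import classical_sets reals constructive_ereal.

Set Implicit Arguments.
Unset Strict Implicit.
Unset Printing Implicit Defensive.

Import Order.TTheory GRing.Theory Num.Theory.
Local Open Scope classical_set_scope.
Local Open Scope ring_scope.

(* Parties are indexed by 'I_n; a seat vector gives m j seats to party j. *)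
Definition allocations (n M : nat) : set {ffun 'I_n -> nat} :=
  [set m | (\sum_(j < n) m j)%N = M].
Arguments allocations : clear implicits.

(* Meaningful for l >= 1 only. *)
Definition increment (R : realType) (phi : nat -> R) (l : nat) : R :=
  phi l - phi l.-1.

(* [psi] is a decomposable error function with components [phi].  Only the
   values of [psi] on the allocations of [M] seats matter. *)
Definition decomposable_error_function (R : realType) (n M : nat)
    (phi : 'I_n -> nat -> R) (psi : {ffun 'I_n -> nat} -> R) : Prop :=
  [/\ forall m, allocations n M m -> 0 <= psi m,
      forall m, allocations n M m -> psi m = \sum_(j < n) phi j (m j),
      forall j l, 0 <= phi j l
    & forall j l l', (0 < l <= l')%N ->
        increment (phi j) l <= increment (phi j) l'].

(* Row i : 'I_M (counted from 0) holds the increments at l = i.+1. *)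
Definition increment_matrix (R : realType) (n M : nat)
    (phi : 'I_n -> nat -> R) : 'M[R]_(M, n) :=
  \matrix_(i < M, j < n) increment (phi j) i.+1.

(* Multisets are sequences up to [perm_eq]. *)
Definition minimal_solution (R : realType) (n M : nat)
    (phi : 'I_n -> nat -> R) : set {ffun 'I_n -> nat} :=
  [set m | allocations n M m /\
    perm_eq
      [seq increment (phi j) l | j <- enum 'I_n, l <- iota 1 (m j)]
      (take M (sort <=%R
        [seq increment_matrix M phi i j | i <- enum 'I_M, j <- enum 'I_n]))].

(* d_l for l >= 1, so that d_1 = d0. *)
Definition linear_divisor (R : realType) (d0 : R) (l : nat) : R :=
  d0 + (l%:R - 1).

Definition quotient_matrix (R : realType) (n M : nat)
    (q : 'I_n -> R) (d0 : R) : 'M[\bar R]_(M, n) :=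
  \matrix_(i < M, k < n)
    if linear_divisor d0 i.+1 == 0 then +oo%E
    else (q k / linear_divisor d0 i.+1)%:E.

(* [S] is a choice of M largest entries; letting [S] vary accounts for all the
   ways of breaking ties. *)
Definition largest_entries (R : realType) (n M : nat)
    (A : 'M[\bar R]_(M, n)) (S : {set 'I_M * 'I_n}) : Prop :=
  #|S| = M /\
  forall p p', p \in S -> p' \notin S -> (A p'.1 p'.2 <= A p.1 p.2)%E.

Definition linear_divisor_method (R : realType) (n M : nat)
    (q : 'I_n -> R) (d0 : R) : set {ffun 'I_n -> nat} :=
  [set m | exists S : {set 'I_M * 'I_n},
    largest_entries (quotient_matrix M q d0) S /\
    forall k, m k = #|[set p in S | p.2 == k]|].

(* Main.v *)
(** With [phi j] as in the theorem, [increment (phi j) l = 2 * d_l / q j - 2],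
    so the increments are ordered inversely to the quotients [q j / d_l], and
    [M] smallest increments are [M] largest quotients.  Since the increments
    are strictly increasing in [l], a choice of [M] smallest entries consists
    of the first [m j] entries of each column [j], hence is determined by its
    seat vector [m]. *)

Require Import Defs.
From mathcomp Require Import all_boot all_order all_algebra.
From mathcomp Require Import classical_sets reals constructive_ereal.
From mathcomp Require Import ring.

Import Order.TTheory GRing.Theory Num.Theory.
Local Open Scope ring_scope.

Lemma perm_map_set_setC {T : finType} {U : eqType} (h : T -> U) (S : {set T}) :
  perm_eq ([seq h x | x in S] ++ [seq h x | x in ~: S]) [seq h x | x : T].
Proof.
rewrite -map_cat; apply: perm_map; apply: uniq_perm.
- rewrite cat_uniq !enum_uniq andbT; apply/hasPn => x.
  by rewrite !mem_enum inE.
- exact: enum_uniq.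
- by move=> x; rewrite mem_cat !mem_enum !inE orbN.
Qed.

(** Only values are compared, so every way of breaking ties is allowed. If the values on [S] are
    dominated by those off [S], the two sorted lists concatenate to a sorted list, which is the
    sorted list of all values by uniqueness. *)
Lemma perm_take_sortP {d : Order.disp_t} {U : orderType d} {T : finType}
    (h : T -> U) (S : {set T}) :
  perm_eq [seq h x | x in S] (take #|S| (sort <=%O [seq h x | x : T])) <->
  (forall x y, x \in S -> y \notin S -> (h x <= h y)%O).
Proof.
have hperm := perm_map_set_setC h S.
have hsize : size [seq h x | x in S] = #|S| by rewrite size_map -cardE.
set s := sort _ _; have ss : sorted <=%O s by exact/sort_sorted/le_total.
split=> [hS x y xS yS | hS].
(* Cancelling the prefix from the multiset of all values identifies the suffix with the values off
   [S]; sortedness then compares the two. *)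
- have hC : perm_eq [seq h x | x in ~: S] (drop #|S| s).
    rewrite -(perm_cat2l (take #|S| s)) cat_take_drop perm_sym perm_sort.
    by rewrite perm_sym -(permPr hperm) perm_cat2r perm_sym.
  move: ss; rewrite (sorted_pairwise le_trans) -(cat_take_drop #|S| s).
  rewrite pairwise_cat => /andP[/allrelP ss _]; apply: ss.
  + by rewrite -(perm_mem hS); apply: map_f; rewrite mem_enum.
  + by rewrite -(perm_mem hC); apply: map_f; rewrite mem_enum inE.
- pose t := sort <=%O [seq h x | x in S] ++ sort <=%O [seq h x | x in ~: S].
  have -> : s = t.
    apply: (sorted_eq le_trans le_anti ss).
    + rewrite (sorted_pairwise le_trans) pairwise_cat.
      rewrite -!(sorted_pairwise le_trans) !sort_sorted ?andbT;
        try exact: le_total.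
      apply/allrelP => a b; rewrite !mem_sort => /mapP[x xS ->] /mapP[y yS ->].
      by move: xS yS; rewrite !mem_enum inE; exact: hS.
    + rewrite perm_sort perm_sym -(permPr hperm).
      by apply: perm_cat; rewrite perm_sort.
  by rewrite take_size_cat ?size_sort // perm_sym perm_sort.
Qed.

(** If [i] is in [A], so are all [i.+1] indices up to [i], whence [i < #|A|]. This inclusion is an
    equality because both sides have the same cardinality. *)
Lemma downset_ordE {M : nat} (A : {set 'I_M}) :
  (forall i j : 'I_M, (i <= j)%N -> j \in A -> i \in A) ->
  A = [set i : 'I_M | (i < #|A|)%N].
Proof.
move=> hA; have cardlt c : (c <= M)%N -> #|[set i : 'I_M | (i < c)%N]| = c.
  move=> cM; rewrite -sum1_card (eq_bigl (fun i : 'I_M => (i < c)%N)).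
    by rewrite -(big_ord_widen M (fun _ => 1%N) cM) sum1_card card_ord.
  by move=> i; rewrite inE.
apply/eqP; rewrite eqEcard cardlt ?leqnn ?andbT; last first.
  by rewrite -[leqRHS]card_ord max_card.
apply/fintype.subsetP => i iA; rewrite inE -(cardlt _ (ltn_ord i)).
by apply/subset_leq_card/fintype.subsetP => j; rewrite inE ltnS => /hA; exact.
Qed.

(** The candidate selection with seat vector [m]: the top cells of each column. A column has only
    [M] cells, so it is cut off there unless [m k <= M]. *)
Definition staircase {n M : nat} (m : {ffun 'I_n -> nat}) :
  {set 'I_M * 'I_n} := [set p : 'I_M * 'I_n | (p.1 < m p.2)%N].

Section Staircase.
Variables (n M : nat) (m : {ffun 'I_n -> nat}).
Hypothesis mM : forall k, (m k <= M)%N.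

(** A general weight [F] covers total size, column sizes and, through indicators of predicates,
    multisets of entries. *)
Lemma sum_staircase (F : nat -> 'I_n -> nat) :
  (\sum_(p in staircase m) F (p : 'I_M * 'I_n).1 p.2 =
   \sum_(k < n) \sum_(i < m k) F i k)%N.
Proof.
under [RHS]eq_bigr => k _ do rewrite (big_ord_widen M (F^~ k) (mM k)).
rewrite (exchange_big_dep xpredT) //= pair_big_dep /=.
by apply: eq_bigl => p; rewrite inE.
Qed.

Lemma card_staircase : #|staircase m : {set 'I_M * 'I_n}| = (\sum_k m k)%N.
Proof.
rewrite -sum1_card (sum_staircase (fun _ _ => 1%N)).
by apply: eq_bigr => k _; rewrite sum1_card card_ord.
Qed.

Lemma card_staircase_col (k : 'I_n) :
  #|[set p in staircase m : {set 'I_M * 'I_n} | p.2 == k]| = m k.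
Proof.
rewrite -sum1_card (eq_bigl (fun p : 'I_M * 'I_n =>
  (p \in staircase m) && (p.2 == k))); last by move=> p; rewrite inE.
rewrite big_mkcondr (sum_staircase (fun _ j => if j == k then 1 else 0)%N).
rewrite (bigD1 k) //= eqxx sum1_card card_ord big1 ?addn0 // => j /negPf ->.
by rewrite big1.
Qed.

(** Two lists are permutations of each other when every predicate has the same count in both, and
    these counts are sums over the staircase. The predecessor converts increments numbered from 1 to
    rows numbered from 0. *)
Lemma perm_staircase {U : eqType} (F : nat -> 'I_n -> U) :
  perm_eq [seq F l.-1 j | j <- enum 'I_n, l <- iota 1 (m j)]
          [seq F p.1 p.2 | p : 'I_M * 'I_n in staircase m].
Proof.
apply/permP => a; rewrite -!sum1_count [LHS]big_mkcond [RHS]big_mkcond.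
rewrite big_allpairs_dep big_enum big_image /=.
rewrite (sum_staircase (fun i k => if a (F i k) then 1 else 0)%N).
apply: eq_bigr => k _.
have -> : iota 1 (m k) = [seq i.+1 | i <- index_iota 0 (m k)].
  by rewrite /index_iota subn0 -(iotaDl 1 0).
by rewrite big_map big_mkord.
Qed.

End Staircase.

Lemma perm_cells {n M : nat} {U : eqType} (F : 'I_M -> 'I_n -> U) :
  perm_eq [seq F i j | i <- enum 'I_M, j <- enum 'I_n]
          [seq F p.1 p.2 | p : 'I_M * 'I_n].
Proof.
apply/permP => a; rewrite -!sum1_count [LHS]big_mkcond [RHS]big_mkcond.
rewrite big_allpairs_dep big_enum big_image /=.
by under eq_bigr do rewrite big_enum /=; rewrite pair_big.
Qed.

(** This trades a condition on multisets of values for the existence of a selection of cells. Strict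
    growth down the columns leaves [staircase m] as the only possible selection. *)
Lemma minimal_solutionE {R : realType} {n M : nat} (phi : 'I_n -> nat -> R)
    (m : {ffun 'I_n -> nat}) :
  (forall j l l', (0 < l < l')%N -> increment (phi j) l < increment (phi j) l') ->
  minimal_solution M phi m <-> exists S : {set 'I_M * 'I_n},
    [/\ #|S| = M,
        forall p p', p \in S -> p' \notin S ->
          increment (phi p.2) p.1.+1 <= increment (phi p'.2) p'.1.+1
      & forall k, m k = #|[set p in S | p.2 == k]|].
Proof.
move=> phiS; pose F (i : nat) (j : 'I_n) := increment (phi j) i.+1.
(* Both multisets become families indexed by cells, and [M] becomes the size of the staircase, to
   fit [perm_take_sortP]. *)
have msE : (forall k, m k <= M)%N -> #|staircase m : {set 'I_M * 'I_n}| = M ->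
  perm_eq [seq increment (phi j) l | j <- enum 'I_n, l <- iota 1 (m j)]
    (take M (sort <=%R
      [seq increment_matrix M phi i j | i <- enum 'I_M, j <- enum 'I_n])) =
  perm_eq [seq F p.1 p.2 | p : 'I_M * 'I_n in staircase m]
    (take #|staircase m : {set 'I_M * 'I_n}|
      (sort <=%R [seq F p.1 p.2 | p : 'I_M * 'I_n])).
  move=> mM ->.
  have -> : [seq increment_matrix M phi i j | i <- enum 'I_M, j <- enum 'I_n] =
            [seq F i j | i : 'I_M <- enum 'I_M, j <- enum 'I_n].
    by apply: eq_allpairs => i j; rewrite mxE.
  have -> : [seq increment (phi j) l | j <- enum 'I_n, l <- iota 1 (m j)] =
            [seq F l.-1 j | j <- enum 'I_n, l <- iota 1 (m j)].
    apply/eq_in_allpairs_dep => j _ l; rewrite mem_iota => /andP[l0 _].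
    by rewrite /F prednK.
  rewrite (permPl (perm_staircase _ _ _ mM F)); congr (perm_eq _ (take _ _)).
  by apply/(perm_sortP le_total le_trans le_anti); exact: perm_cells.
split=> [[mA] | [S [cS hS mE]]].
- have mM k : (m k <= M)%N by rewrite -mA (bigD1 k) //= leq_addr.
  have cD : #|staircase m : {set 'I_M * 'I_n}| = M by rewrite card_staircase.
  rewrite msE // => /perm_take_sortP hD; exists (staircase m); split=> //.
  by move=> k; rewrite card_staircase_col.
- have colE k : #|[set i | (i, k) \in S]| = m k.
    rewrite mE -(card_imset _ (fun i j => fun e : (i, k) = (j, k) =>
      congr1 fst e)); congr #|pred_of_set _|.
    apply/setP => -[i j]; rewrite inE /=; apply/imsetP/andP.
      by move=> [i']; rewrite inE => iS [-> ->].
    by move=> [iS /eqP <-]; exists i; rewrite ?inE.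
  have SD : S = staircase m.
    apply/setP => -[i k]; rewrite inE /= -colE.
    have := @downset_ordE M [set i | (i, k) \in S].
    move=> /(_ _) /setP/(_ i); rewrite !inE; apply=> a b; rewrite !inE.
    rewrite leq_eqVlt => /orP[/eqP/val_inj-> //|ab bS].
    (* A skipped cell [a] above a selected cell [b] would have an entry at least that of [b],
       against strict growth. *)
    apply: contraT => aS; have := hS _ _ bS aS => /=.
    by rewrite leNgt phiS.
  have mM k : (m k <= M)%N by rewrite -colE -[leqRHS]card_ord max_card.
  have cD : #|staircase m : {set 'I_M * 'I_n}| = M by rewrite -SD.
  split; first by rewrite /allocations /= -[RHS]cD card_staircase.
  by rewrite msE //; apply/perm_take_sortP; rewrite -SD.
Qed.

(** Taking reciprocals reverses the order of positive numbers; the convention [+oo] for a zero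
    divisor extends this to the reciprocal of 0. *)
Lemma le_quotient {R : realType} (x y a b : R) :
  0 < x -> 0 < y -> 0 <= a -> 0 <= b ->
  ((if b == 0%R then +oo else (y / b)%:E) <=
   (if a == 0%R then +oo else (x / a)%:E))%E = (a / x <= b / y).
Proof.
move=> x0 y0; rewrite !le0r => /predU1P[-> | a0] /predU1P[-> | b0].
- by rewrite eqxx leey !mul0r lexx.
- by rewrite eqxx leey mul0r divr_ge0 // ltW.
- by rewrite eqxx gt_eqF // mul0r leye_eq leNgt divr_gt0.
- rewrite !gt_eqF // lee_fin -[y / b]invf_div -[x / a]invf_div.
  by rewrite lef_pV2 // posrE divr_gt0.
Qed.

Theorem corollary6p3 (R : realType) (n M : nat) (hn : (0 < n)%N) (hM : (0 < M)%N)
    (q : 'I_n -> R) (hq : forall j, 0 < q j) (hsum : \sum_(j < n) q j = M%:R)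
    (d0 : R) (hd0 : 0 <= d0) :
  let phi := fun (j : 'I_n) (x : nat) =>
    1 / q j * (x%:R - q j + d0 - 1 / 2) ^+ 2 in
  let psi := fun m : {ffun 'I_n -> nat} => \sum_(j < n) phi j (m j) in
  decomposable_error_function M phi psi /\
  minimal_solution M phi = linear_divisor_method M q d0.
Proof.
move=> phi psi.
(* The difference of squares is [2 * (l - q j + d0 - 1/2) - 1]; the shift by one half in [phi] makes
   it exactly [2 * d_l - 2 * q j]. *)
have incE j l : (0 < l)%N ->
    increment (phi j) l = 2 * (linear_divisor d0 l / q j) - 2.
  case: l => // l _; rewrite /increment /phi /linear_divisor /= -natr1.
  by field; rewrite gt_eqF.
have phi0 j l : 0 <= phi j l.
  by rewrite /phi mulr_ge0 ?sqr_ge0 // divr_ge0 // ltW.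
have phiS j l l' : (0 < l < l')%N ->
    increment (phi j) l < increment (phi j) l'.
  move=> /andP[l0 ll']; rewrite !incE //; last exact: ltn_trans ll'.
  rewrite ltrD2r ltr_pM2l //.
  by rewrite ltr_pM2r ?invr_gt0 // /linear_divisor !ltrD2l ltrD2r ltr_nat.
have div0 l : 0 <= linear_divisor d0 l.+1.
  by rewrite /linear_divisor -natr1 addrK addr_ge0.
(* Since [t] maps to [2 * t - 2] increasingly, the same set [S] is a valid choice for both
   methods. *)
have entryE (p p' : 'I_M * 'I_n) :
    (quotient_matrix M q d0 p'.1 p'.2 <= quotient_matrix M q d0 p.1 p.2)%E =
    (increment (phi p.2) p.1.+1 <= increment (phi p'.2) p'.1.+1).
  by rewrite !mxE le_quotient // !incE // lerD2r ler_pM2l.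
split.
- split=> // [m _ | j l l' /andP[l0]]; first exact: sumr_ge0.
  by rewrite leq_eqVlt => /predU1P[-> // | ll']; rewrite ltW ?phiS ?l0.
- apply/seteqP; split=> m.
  + move=> /(minimal_solutionE _ _ phiS)[S [cS hS mS]]; exists S; split=> //.
    by split=> // p p' pS p'S; rewrite entryE; exact: hS.
  + move=> [S [[cS hS] mS]]; apply/(minimal_solutionE _ _ phiS).
    by exists S; split=> // p p' pS p'S; rewrite -entryE; exact: hS.
Qed.
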